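(* Let $f:2^X\to\mathbb{R}_{\ge0}$ be a monotone nondecreasing function (not necessarily submodular) with curvature at most $c\in[0,1]$, and let $\mathcal{M}=(X,\mathcal{I})$ be a matroid. Let $S$ be the base produced by the standard greedy minimization algorithm on $f$ and $\mathcal{M}$, and let $O$ be any base of $\mathcal{M}$. Then $f(S)\le\frac{1}{1-c}f(O)$.
   Context: $f_A(j)=f(A\cup\{j\})-f(A)$. For a monotone function, the (generalized) curvature is $c=1-\min_{j\in X}\min_{S,T\subseteq X\setminus\{j\}}\frac{f_S(j)}{f_T(j)}$; for nondecreasing $f$, curvature at most $c$ means $(1-c)f_B(j)\le f_A(j)$ for all $j\in X$, $A,B\subseteq X\setminus\{j\}$. The standard greedy minimization algorithm starts from $S=\emptyset$ and repeatedly adds to $S$ an element $e\notin S$ with $S\cup\{e\}\in\mathcal{I}$ minimizing $f_S(e)$, terminating only when no element can be added. *)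

(* Defs.v *)
From mathcomp Require Import all_boot all_order all_algebra.

Set Implicit Arguments.
Unset Strict Implicit.
Unset Printing Implicit Defensive.

Import Order.TTheory GRing.Theory Num.Theory.
Local Open Scope ring_scope.

(* The ground set is the whole finite type X. *)
Record matroid (X : finType) : Type := Matroid {
  indep : {set {set X}};
  indep0 : set0 \in indep;
  indep_sub : forall A B : {set X}, A \subset B -> B \in indep -> A \in indep;
  indep_exch : forall A B : {set X},
    A \in indep -> B \in indep -> (#|A| < #|B|)%N ->
    exists2 e, e \in B :\: A & e |: A \in indep
}.

Definition base (X : finType) (M : matroid X) (B : {set X}) : bool :=
  maxset [pred A | A \in indep M] B.

Definition set_nondecreasing (R : realFieldType) (X : finType)
    (f : {set X} -> R) : Prop :=
  forall A B : {set X}, A \subset B -> f A <= f B.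

Definition marginal (R : realFieldType) (X : finType) (f : {set X} -> R)
    (A : {set X}) (j : X) : R :=
  f (j |: A) - f A.

(* Division-free form, appropriate for nondecreasing f; A and B are not
   assumed to be comparable. *)
Definition curvature_at_most (R : realFieldType) (X : finType)
    (f : {set X} -> R) (c : R) : Prop :=
  forall (j : X) (A B : {set X}), j \notin A -> j \notin B ->
    (1 - c) * marginal f B j <= marginal f A j.

Definition feasible (X : finType) (M : matroid X) (S : {set X}) (e : X) : bool :=
  (e \notin S) && (e |: S \in indep M).

(* The sets met during a run; ties are broken arbitrarily, so this is a
   predicate rather than a function. *)
Inductive greedy_reachable (R : realFieldType) (X : finType)
    (f : {set X} -> R) (M : matroid X) : {set X} -> Prop :=
| greedy_start : greedy_reachable f M set0
| greedy_step (S : {set X}) (e : X) :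
    greedy_reachable f M S -> feasible M S e ->
    (forall e', feasible M S e' -> marginal f S e <= marginal f S e') ->
    greedy_reachable f M (e |: S).

(* Such an S is necessarily a base: it is independent and cannot be extended. *)
Definition greedy_output (R : realFieldType) (X : finType)
    (f : {set X} -> R) (M : matroid X) (S : {set X}) : Prop :=
  greedy_reachable f M S /\ forall e, ~~ feasible M S e.

(* Main.v *)
(* Along a greedy run, (1 - c) f(A) <= f(T) for every independent T with
   #|A| <= #|T|, where A is the current greedy set: when greedy adds e to A, the
   exchange axiom provides o in T \ A that was also feasible, so curvature gives
   (1 - c) f_A(e) <= (1 - c) f_A(o) <= f_(T \ o)(o), and induction applies to
   A and T \ o. *)
Require Import Defs.
From mathcomp Require Import all_boot all_order all_algebra.

Set Implicit Arguments.
Unset Strict Implicit.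
Unset Printing Implicit Defensive.

Import Order.TTheory GRing.Theory Num.Theory.
Local Open Scope ring_scope.

Lemma greedy_reachable_indep (R : realFieldType) (X : finType)
    (f : {set X} -> R) (M : matroid X) (A : {set X}) :
  greedy_reachable f M A -> A \in indep M.
Proof. by case=> [|S e _ /andP[]//]; exact: indep0. Qed.

Lemma base_indep (X : finType) (M : matroid X) (B : {set X}) :
  base M B -> B \in indep M.
Proof. by case/maxsetP. Qed.

(** Otherwise exchange would enlarge [B] within [indep M], against maximality. *)
Lemma card_indep_le_base (X : finType) (M : matroid X) (A B : {set X}) :
  A \in indep M -> base M B -> (#|A| <= #|B|)%N.
Proof.
move=> AI B_base; rewrite leqNgt; apply/negP => ltBA.
have [e /setDP[_ eNB] eBI] := indep_exch (base_indep B_base) AI ltBA.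
have/maxsetP[_ B_max] := B_base.
by move: eNB; rewrite -(B_max _ eBI (subsetUr _ _)) setU11.
Qed.

Lemma greedy_reachable_le_indep (R : realFieldType) (X : finType)
    (f : {set X} -> R) (M : matroid X) (c : R) (A T : {set X}) :
  (forall B : {set X}, 0 <= f B) -> set_nondecreasing f ->
  0 <= c <= 1 -> curvature_at_most f c ->
  greedy_reachable f M A -> T \in indep M -> (#|A| <= #|T|)%N ->
  (1 - c) * f A <= f T.
Proof.
move=> f_ge0 f_mono /andP[c_ge0 c_le1] f_curv A_greedy.
(* [T] stays general, since the induction hypothesis is used at [T :\ o]. *)
elim: A_greedy T => [|{}A e A_greedy IH e_feas e_min] T TI.
  (* [f set0] may be positive; [1 - c <= 1] then suffices. *)
  move=> _; apply: le_trans (f_mono _ _ (sub0set T)).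
  by rewrite ler_piMl // lerBlDr lerDl.
have /andP[eNA _] := e_feas.
rewrite cardsU1 eNA add1n => ltAT.
have [o /setDP[oT oNA] oAI] := indep_exch (greedy_reachable_indep A_greedy) TI ltAT.
have oNT : o \notin T :\ o by rewrite setD11.
have le_AT : (1 - c) * f A <= f (T :\ o).
  apply: IH; first exact: indep_sub (subD1set T o) TI.
  by move: ltAT; rewrite (cardsD1 o T) oT.
have le_eo : (1 - c) * marginal f A e <= (1 - c) * marginal f A o.
  apply: ler_wpM2l; first by rewrite subr_ge0.
  by apply: e_min; rewrite /feasible oNA.
(* Curvature compares [o] over [A] and [T :\ o], which need not be nested; both sides of the sum
   telescope. *)
have := lerD le_AT (le_trans le_eo (f_curv _ _ _ oNT oNA)).
by rewrite /marginal setD1K // -mulrDr !subrKC.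
Qed.

(* For c = 1 the factor 1 / (1 - c) is infinite and nothing is claimed; the
   premise c < 1 keeps it from being read as 1 / 0 = 0. *)
Theorem theorem12 (R : realFieldType) (X : finType) (f : {set X} -> R)
    (M : matroid X) (c : R) (S O : {set X})
    (f_ge0 : forall A : {set X}, 0 <= f A)
    (f_mono : set_nondecreasing f)
    (c_ge0 : 0 <= c) (c_le1 : c <= 1)
    (f_curv : curvature_at_most f c)
    (S_greedy : greedy_output f M S)
    (O_base : base M O) :
  c < 1 -> f S <= 1 / (1 - c) * f O.
Proof.
move=> c_lt1; have [S_reach _] := S_greedy.
rewrite mul1r mulrC ler_pdivlMr ?subr_gt0 // mulrC.
apply: (greedy_reachable_le_indep f_ge0 f_mono _ f_curv S_reach).
- by rewrite c_ge0.
- exact: base_indep O_base.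
- exact: card_indep_le_base (greedy_reachable_indep S_reach) O_base.
Qed.
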